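(* Consider a structured problem in the class $\mathcal{SP}(m_f,\sigma_f,\bar\sigma_f,L,\delta)$ with $L(\cdot)=L\ge0$ constant, $\sigma_f>0$, and $\delta(y,x)=\frac{M(y)}\rho\|y-x\|^\rho$ for some $\rho\in[1,2)$ and a function $M(\cdot)\ge0$ on $Q$. Let $\{(z_{k-1},w_{k-1},x_k,\hat x_k)\}_{k\ge0}$ be generated by the modified method of Method S with $$\lambda_k:=\frac1{p+1}(k+1)^p,\qquad\beta_k:=\left(\frac L{\sigma_d}+\beta\right)(k+2)^{p-1},$$ where $p\ge1$ and $\beta\ge0$ satisfy $\sigma_d\bar\sigma_f+pL+(p+1)\sigma_d\beta>0$. Then for every $k\ge0$ $$f(\hat x_k)-f(x^* )+\sigma_f\xi(z_k,x^* )\le\left(\frac L{\sigma_d}+\beta\right)(p+1)^2l_d(z_k;x^* )\frac{(k+2)^{p-1}}{(k+1)^{p+1}}$$ $$+\frac{(p+1)(2-\rho)\max_{0\le i\le k}M(x_i)^{\frac2{2-\rho}}}{2\rho(\sigma_d\bar\sigma_f+pL+(p+1)\sigma_d\beta)^{\frac\rho{2-\rho}}}\cdot\frac1{(k+1)^{p+1}}$$ $$+\frac{3^{p+1}(2-\rho)\max_{0\le i\le k}M(x_i)^{\frac2{2-\rho}}}{2\rho}\left(\frac{2^{p-1}(p+1)^2}{\sigma_d\sigma_f}\right)^{\frac\rho{2-\rho}}P(k),$$ where $$P(k)=\begin{cases}\left(p+2-\frac{2\rho}{2-\rho}\right)^{-1}(k+1)^{-\frac{3\rho-2}{2-\rho}}&\text{if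 }p+1>\frac{3\rho-2}{2-\rho},\\[1mm]\dfrac{1+\log k}{(k+1)^{p+1}}&\text{if }p+1=\frac{3\rho-2}{2-\rho},\\[2mm]\dfrac{1-\left(p+2-\frac{2\rho}{2-\rho}\right)^{-1}}{(k+1)^{p+1}}&\text{if }p+1<\frac{3\rho-2}{2-\rho},\end{cases}$$ and in the case $p+1=\frac{3\rho-2}{2-\rho}$ the estimate is asserted for $k\ge1$.
   Context: Setting. $E$ is a finite-dimensional real normed space with norm $\|\cdot\|$; $E^*$ is its dual, with pairing $\langle s,x\rangle$. $Q\subset E$ is a closed convex set and $f:E\to\mathbb R\cup\{+\infty\}$ is a lower-semicontinuous (lsc) convex function with $Q\subset \mathrm{dom} f$. The problem $\min_{x\in Q}f(x)$ is assumed to have an optimal solution; $x^*\in Q$ denotes one. A prox-function $d:E\to\mathbb R\cup\{+\infty\}$ is fixed: $d$ is nonnegative, continuously differentiable and strongly convex on $Q$ ($Q\subset\mathrm{dom}\,d$) with constant $\sigma_d>0$ with respect to $\|\cdot\|$, and $d(x_0)=\min_{x\in Q}d(x)=0$ for its unique minimizer $x_0\in Q$. For $x,y\in Q$: $l_d(y;x):=d(y)+\langle\nabla d(y),x-y\rangle$ and $\xi(y,x):=d(x)-l_d(y;x)$ (Bregman distance). For an lsc convex $\psi:E\to\mathbb R\cup\{+\infty\}$ with $Q\subset\mathrm{dom}\,\psi$, $\sigma(\psi):=\{\tau\ge0:\psi(x)-\tau d(x)\text{ is an lsc convex function on }Q\}$. Class $\mathcal{SP}(m_f,\sigma_f,\bar\sigma_f,L,\delta)$: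 problems $\min_{x\in Q}f(x)$ for which the following are given. For each $y\in Q$, $m_f(y;\cdot):E\to\mathbb R\cup\{+\infty\}$ is an lsc convex function (with $Q$ in its domain) with $m_f(y;x)\le f(x)$ for all $x\in Q$; $\sigma_f\ge0$ satisfies $\sigma_f\in\sigma(f)\cap\bigcap_{y\in Q}\sigma(m_f(y;\cdot))$; $\bar\sigma_f\in[0,\sigma_f]$; $L(\cdot)\ge0$ is a function on $Q$; $\delta(y,\cdot)$ is a nonnegative convex function on $Q$ for each $y\in Q$; and $$f(x)\le[m_f(y;x)-\bar\sigma_f\xi(y,x)]+\tfrac{L(y)}2\|y-x\|^2+\delta(y,x)\quad\forall x,y\in Q.$$ Subproblems $\min_{x\in Q}\{m_f(y;x)+\langle s,x\rangle+\beta d(x)\}$ ($\beta\ge0$, $s\in E^*$) are assumed solvable. Parameters. Weight parameters $\lambda_k>0$ ($k\ge0$); scaling parameters $\beta_k\ge0$ ($k\ge-1$), nondecreasing in $k$. $S_k:=\sum_{i=0}^k\lambda_i$, $S_{-1}:=0$. Property 2 for a coupled sequence of functions $\{(\varphi_k(x),\psi_k(x))\}_{k\ge-1}$ (associated with $\{\lambda_k\},\{\beta_k\}$ and test points $\{x_k\}_{k\ge0}$), with $z_k:=\mathrm{argmin}_{x\in Q}\varphi_k(x)$, $w_k:=\mathrm{argmin}_{x\in Q}\psi_k(x)$ (minimizers assumed to exist): (B0) $\varphi_k(x)\ge\psi_k(x)$ for all $x\in Q$, $k\ge -1$. (B1) $\psi_{-1}(w_{-1})=0$ and $z_{-1}=w_{-1}=x_0$.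 (B2) For all $k\ge-1$, $x\in Q$: $\psi_{k+1}(x)\ge\varphi_k(z_k)+\lambda_{k+1}m_f(x_{k+1};x)+\beta_{k+1}d(x)-\beta_kl_d(z_k;x)+S_k\sigma_f\xi(z_k,x)$. (B3) For all $k\ge-1$: $\psi_k(w_k)\le\min_{x\in Q}\{\sum_{i=0}^k\lambda_im_f(x_i;x)+\beta_kl_d(z_k;x)-S_k\sigma_f\xi(z_k,x)\}$. Method S, modified variant. With a coupled sequence $\{(\varphi_k,\psi_k)\}_{k\ge-1}$ satisfying Property 2: set $x_0:=z_{-1}:=w_{-1}:=\mathrm{argmin}_{x\in Q}d(x)$, $z_0:=\mathrm{argmin}_{x\in Q}\varphi_0(x)$, $\hat x_0:=w_0:=\mathrm{argmin}_{x\in Q}\psi_0(x)$. For $k\ge0$ set $x_{k+1}:=\frac{S_k\hat x_k+\lambda_{k+1}z_k}{S_{k+1}}$, $z_{k+1}:=\mathrm{argmin}_{x\in Q}\varphi_{k+1}(x)$, $w_{k+1}:=\mathrm{argmin}_{x\in Q}\psi_{k+1}(x)$, $\hat x_{k+1}:=\frac{S_k\hat x_k+\lambda_{k+1}w_{k+1}}{S_{k+1}}$. *)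

(* Defs.v *)
From HB Require Import structures.
From mathcomp Require Import all_boot all_order all_algebra.
From mathcomp Require Import all_classical all_reals all_analysis.

Set Implicit Arguments.
Unset Strict Implicit.
Unset Printing Implicit Defensive.
Import Order.TTheory GRing.Theory Num.Theory.
Import numFieldNormedType.Exports.
Local Open Scope classical_set_scope.
Local Open Scope ring_scope.

#[short(type="normedVectType")]
HB.structure Definition NormedVector (R : numFieldType) :=
  {E of NormedModule R E & Vector R E}.

Section Functions.
Context {R : realType} {E : normedVectType R}.
Implicit Types (Q : set E) (h d : E -> \bar R).

Definition convex_on Q h :=
  forall x y (t : R), Q x -> Q y -> 0 <= t <= 1 ->
    (h (t *: x + (1 - t) *: y)%R <= t%:E * h x + (1 - t)%:E * h y)%E.

(* Relative lower semicontinuity, as in {within Q, continuous _}. *)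
Definition lsc_on Q h := lower_semicontinuous (h : subspace Q -> \bar R).

(* lsc convex functions E -> R \cup {+oo} whose domain contains Q *)
Record lsc_convex Q h : Prop := LscConvex {
  lsc_convex_ninfty : forall x, h x != -oo%E ;
  lsc_convex_dom : forall x, Q x -> (h x < +oo)%E ;
  lsc_convex_lsc : lower_semicontinuous h ;
  lsc_convex_convex : convex_on setT h }.

Definition strongly_convex_on Q (sd : R) h :=
  forall x y (t : R), Q x -> Q y -> 0 <= t <= 1 ->
    (h (t *: x + (1 - t) *: y)%R <=
      t%:E * h x + (1 - t)%:E * h y
      - (sd / 2 * (t * (1 - t)) * `|x - y| ^+ 2)%:E)%E.

Definition is_argmin Q h x := Q x /\ forall y, Q y -> (h x <= h y)%E.

End Functions.

Section Prox.
Context {R : realType} {E : normedVectType R}.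
(* The prox-function d together with its gradient gd on Q; the dual space E^*
   is {scalar E}. *)
Variables (Q : set E) (d : E -> \bar R) (gd : E -> {scalar E}).

(* ld y x and xi y x are used at points y, x of Q only, where d is finite. *)
Definition ld (y x : E) : R := fine (d y) + gd y (x - y).
Definition xi (y x : E) : R := fine (d x) - ld y x.

(* Differentiability is relative to Q, since d may be +oo outside Q: for y in Q,
   d x = d y + <gd y, x - y> + o(|x - y|) as x tends to y in Q; moreover gd is
   continuous on Q for the dual norm. *)
Definition C1_on : Prop :=
  (forall y, Q y -> forall e : R, 0 < e ->
     \forall x \near within Q (nbhs y), `|xi y x| <= e * `|x - y|) /\
  (forall y, Q y -> forall e : R, 0 < e ->
     \forall x \near within Q (nbhs y),
       forall v : E, `|gd x v - gd y v| <= e * `|v|).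

Record prox_function (sd : R) (x0 : E) : Prop := ProxFunction {
  prox_ninfty : forall x, d x != -oo%E ;
  prox_dom : forall x, Q x -> (d x < +oo)%E ;
  prox_ge0 : forall x, Q x -> (0 <= d x)%E ;
  prox_C1 : C1_on ;
  prox_sd_gt0 : 0 < sd ;
  prox_strong : strongly_convex_on Q sd d ;
  prox_argmin : is_argmin Q d x0 ;
  prox_min0 : d x0 = 0%E ;
  prox_uniq : forall x, is_argmin Q d x -> x = x0 }.

Definition sigma (h : E -> \bar R) : set R :=
  [set tau | 0 <= tau /\
     lsc_on Q (fun x => h x - tau%:E * d x)%E /\
     convex_on Q (fun x => h x - tau%:E * d x)%E].

(* Membership of min_(x in Q) f x in the class SP(m, sf, sbf, L, delta). *)
Record SP_class (f : E -> \bar R) (m : E -> E -> \bar R) (sf sbf : R)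
    (L : E -> R) (delta : E -> E -> R) : Prop := SPClass {
  SP_model : forall y, Q y -> lsc_convex Q (m y) ;
  SP_minor : forall y x, Q y -> Q x -> (m y x <= f x)%E ;
  SP_sf_f : sigma f sf ;
  SP_sf_m : forall y, Q y -> sigma (m y) sf ;
  SP_sbf : 0 <= sbf <= sf ;
  SP_L : forall y, Q y -> 0 <= L y ;
  SP_delta_ge0 : forall y x, Q y -> Q x -> 0 <= delta y x ;
  SP_delta_convex : forall y, Q y -> convex_on Q (fun x => (delta y x)%:E) ;
  SP_upper : forall y x, Q y -> Q x ->
    (f x <= (m y x - (sbf * xi y x)%:E)
            + (L y / 2 * `|y - x| ^+ 2)%:E + (delta y x)%:E)%E ;
  SP_solvable : forall y (s : {scalar E}) (b : R), Q y -> 0 <= b ->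
    exists u, is_argmin Q (fun x => m y x + (s x)%:E + b%:E * d x)%E u }.

(* Index convention: the sequences beta, S, phi, psi, z, w, which start at
   index -1, are shifted by one (beta n stands for beta_(n-1), and so on);
   lam, x and xh, which start at index 0, are not. *)

Definition Ssum (lam : nat -> R) (n : nat) : R := \sum_(i < n) lam i.

Record property2 (m : E -> E -> \bar R) (sf : R) (lam beta : nat -> R)
    (x0 : E) (phi psi : nat -> E -> \bar R) (x z w : nat -> E) : Prop :=
  Property2 {
  P2_ninfty : forall n u, Q u -> phi n u != -oo%E /\ psi n u != -oo%E ;
  P2_z : forall n, is_argmin Q (phi n) (z n) ;
  P2_w : forall n, is_argmin Q (psi n) (w n) ;
  P2_B0 : forall n u, Q u -> (psi n u <= phi n u)%E ;
  P2_B1 : psi 0%N (w 0%N) = 0%E /\ z 0%N = x0 /\ w 0%N = x0 ;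
  P2_B2 : forall n u, Q u ->
    (phi n (z n) + (lam n)%:E * m (x n) u + (beta n.+1)%:E * d u
       - (beta n * ld (z n) u)%:E + (Ssum lam n * sf * xi (z n) u)%:E
     <= psi n.+1 u)%E ;
  P2_B3 : forall n,
    (psi n (w n) <= ereal_inf
       [set (\sum_(i < n) (lam i)%:E * m (x i) u
               + (beta n * ld (z n) u)%:E
               - (Ssum lam n * sf * xi (z n) u)%:E) | u in Q])%E }.

(* The points generated by the modified variant of the method; z and w are
   constrained by property2. *)
Record modified_method (lam : nat -> R) (x0 : E) (x xh z w : nat -> E) : Prop :=
  ModifiedMethod {
  MM_x0 : x 0%N = x0 ;
  MM_xh0 : xh 0%N = w 1%N ;
  MM_x : forall k, x k.+1 =
    (Ssum lam k.+2)^-1 *: (Ssum lam k.+1 *: xh k + lam k.+1 *: z k.+1) ;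
  MM_xh : forall k, xh k.+1 =
    (Ssum lam k.+2)^-1 *: (Ssum lam k.+1 *: xh k + lam k.+1 *: w k.+2) }.

End Prox.

Section Rates.
Context {R : realType}.

Definition lambda_ (p : R) (k : nat) : R := (p + 1)^-1 * k.+1%:R `^ p.

(* with the shift: index n stands for k = n - 1, so k + 2 = n + 1 *)
Definition beta_ (L sd b p : R) (n : nat) : R :=
  (L / sd + b) * n.+1%:R `^ (p - 1).

Definition rateP (p rho : R) (k : nat) : R :=
  let t := (3 * rho - 2) / (2 - rho) in
  let q := p + 2 - 2 * rho / (2 - rho) in
  if t < p + 1 then q^-1 * k.+1%:R `^ (- t)
  else if p + 1 == t then (1 + ln k%:R) / k.+1%:R `^ (p + 1)
  else (1 - q^-1) / k.+1%:R `^ (p + 1).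

End Rates.

(* Main.v *)
(* The estimate rests on S_k f(hat x_k) <= psi_k(w_k) + sum of step errors,
   proved by induction on k. In one step, (B2) provides the gain
   (beta_k + S_k sigma_f) xi(z_k, w_(k+1)), which strong convexity of the prox
   function bounds below by a multiple of |w_(k+1) - z_k|^2. Since
   hat x_(k+1) - x_(k+1) is a multiple of w_(k+1) - z_k, this gain absorbs the
   quadratic part of the upper model at x_(k+1), leaving a curvature C_k with
   step error S_k max_r (M/rho r^rho - C_k/2 r^2), evaluated by Young's
   inequality. For the given weights C_k grows like k^2 and S_k like k^(p+1), so
   the errors add up to a power sum with exponent p + 1 - 2 rho/(2 - rho); its
   three regimes are the three cases of P. Evaluating (B3) at x^* closes the
   argument. *)
Require Import Defs.
From HB Require Import structures.
From mathcomp Require Import all_boot all_order all_algebra.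
From mathcomp Require Import all_classical all_reals all_analysis.
From mathcomp Require Import ring lra.

Set Implicit Arguments.
Unset Strict Implicit.
Unset Printing Implicit Defensive.
Import Order.TTheory GRing.Theory Num.Theory.
Import numFieldNormedType.Exports.
Local Open Scope classical_set_scope.
Local Open Scope ring_scope.

(** * Tangent inequalities for real powers, and power sums *)

Section PowerInequalities.
Context {R : realType}.
Implicit Types (a s x y : R).

(** Young's inequality for the product [x * 1] with conjugate exponents [s] and [s / (s - 1)]; at
    [s = 1] the second exponent degenerates, so that case is separate. *)
Lemma bernoulli_ge1 s x : 1 <= s -> 0 <= x -> 1 + s * (x - 1) <= x `^ s.
Proof.
rewrite le_eqVlt => /predU1P[<- x0|s1 x0]; first by rewrite powRr1//; lra.
have s0 : 0 < s by lra.
have q0 : 0 < s / (s - 1) by rewrite divr_gt0 ?subr_gt0.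
have := conjugate_powR x0 (@ler01 R) s0 q0; rewrite powR1 mulr1.
have e : s^-1 + (s / (s - 1))^-1 = 1 by field; apply/andP; split; lra.
move=> /(_ e) H.
have -> : x `^ s = s * (x `^ s / s) by field; lra.
have -> : 1 + s * (x - 1) = s * (x - (s - 1) / s) by field; lra.
rewrite ler_pM2l// lerBlDr (le_trans H)// lerD2l.
by rewrite div1r invf_div.
Qed.

Lemma bernoulli_le1 s x : 0 < s <= 1 -> 0 <= x -> x `^ s <= 1 + s * (x - 1).
Proof.
move=> /andP[s0 s1] x0.
have si : 1 <= s^-1 by rewrite invr_ge1// unitfE gt_eqF.
have := bernoulli_ge1 si (powR_ge0 x s).
rewrite -powRrM divff ?gt_eqF// powRr1// => H.
rewrite -lerBlDl -(ler_pM2l (_ : 0 < s^-1)) ?invr_gt0// mulKf ?gt_eqF//.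
lra.
Qed.

(** Combines [exp v >= 1 + v] at [v = s * ln x] with [ln x <= x - 1], which is reversed by the
    factor [s <= 0]. *)
Lemma bernoulli_le0 s x : s <= 0 -> 0 < x -> 1 + s * (x - 1) <= x `^ s.
Proof.
move=> s0 x0; rewrite /powR gt_eqF//.
apply: le_trans (expR_ge1Dx _); rewrite lerD2l.
have := @le_ln1Dx R (x - 1); rewrite addrCA subrr addr0 => H.
by rewrite ler_wnM2l// H; lra.
Qed.

Lemma powR_div s x y : 0 < y -> 0 <= x ->
  (x / y) `^ s = x `^ s / y `^ s.
Proof.
move=> y0 x0; rewrite powRM ?invr_ge0 ?(ltW y0)//; congr (_ * _).
by rewrite -powR_inv1 ?ltW// -powRrM mulN1r powRN.
Qed.

Let powR_pred s y : 0 < y -> y `^ (s - 1) = y `^ s / y.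
Proof. by move=> y0; rewrite powRB ?powRr1 ?ltW// (gt_eqF y0) implybT. Qed.

Let tangentE s x y : 0 < y -> 0 <= x ->
  y `^ s * (1 + s * (x / y - 1)) = y `^ s + s * y `^ (s - 1) * (x - y).
Proof. by move=> y0 x0; rewrite powR_pred//; field; lra. Qed.

Lemma powR_tangent_ge s x y : 1 <= s -> 0 <= x -> 0 < y ->
  y `^ s + s * y `^ (s - 1) * (x - y) <= x `^ s.
Proof.
move=> s1 x0 y0; have ys0 := powR_gt0 s y0.
have xy0 : 0 <= x / y by rewrite divr_ge0// ltW.
have := bernoulli_ge1 s1 xy0.
by rewrite powR_div// ler_pdivlMr// mulrC tangentE.
Qed.

Lemma powR_tangent_le s x y : 0 < s <= 1 -> 0 <= x -> 0 < y ->
  x `^ s <= y `^ s + s * y `^ (s - 1) * (x - y).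
Proof.
move=> s1 x0 y0; have ys0 := powR_gt0 s y0.
have xy0 : 0 <= x / y by rewrite divr_ge0// ltW.
have := bernoulli_le1 s1 xy0.
by rewrite powR_div// ler_pdivrMr// mulrC tangentE.
Qed.

Lemma powR_tangent_le0 s x y : s <= 0 -> 0 < x -> 0 < y ->
  y `^ s + s * y `^ (s - 1) * (x - y) <= x `^ s.
Proof.
move=> s1 x0 y0; have ys0 := powR_gt0 s y0.
have xy0 : 0 < x / y by rewrite divr_gt0.
have := bernoulli_le0 s1 xy0.
by rewrite powR_div ?(ltW x0)// ler_pdivlMr// mulrC tangentE// ltW.
Qed.

Let natS0 n : 0 < n.+1%:R :> R. Proof. by rewrite ltr0n. Qed.
Let natSB n : n.+1%:R - n%:R = 1 :> R. Proof. by rewrite -natr1; ring. Qed.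
Let natBS n : n%:R - n.+1%:R = -1 :> R. Proof. by rewrite -natr1; ring. Qed.

Lemma sum_powR_ge a n : 0 <= a ->
  n%:R `^ (a + 1) / (a + 1) <= \sum_(i < n) i.+1%:R `^ a.
Proof.
move=> a0; elim: n => [|n IH].
  by rewrite big_ord0 powR0 ?mul0r//; lra.
rewrite big_ord_recr/=; apply: le_trans (lerD IH (lexx _)).
have a1 : 1 <= a + 1 by lra.
have := powR_tangent_ge a1 (ler0n R n) (natS0 n).
rewrite natBS addrK mulrN1 => H.
rewrite ler_pdivrMr ?mulrDl ?divfK; lra.
Qed.

Lemma sum_powR_le a n : 0 <= a ->
  \sum_(i < n) i.+1%:R `^ a <= n.+1%:R `^ (a + 1) / (a + 1).
Proof.
move=> a0; elim: n => [|n IH].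
  by rewrite big_ord0 divr_ge0 ?powR_ge0//; lra.
rewrite big_ord_recr/=; apply: le_trans (lerD IH (lexx _)) _.
have a1 : 1 <= a + 1 by lra.
have := powR_tangent_ge a1 (ler0n R n.+2) (natS0 n).
rewrite natSB addrK mulr1 => H.
rewrite ler_pdivlMr ?mulrDl ?divfK; lra.
Qed.

(** For [a < 0] the power [a + 1] is concave, and telescoping its tangents gives the bound with [n];
    this is weakened to [n.+1] to match the case [0 <= a]. *)
Lemma sum_powR_le_gtN1 a n : -1 < a ->
  \sum_(i < n) i.+1%:R `^ a <= n.+1%:R `^ (a + 1) / (a + 1).
Proof.
move=> aN1; have [/sum_powR_le//|a0] := leP 0 a.
have ap : 0 < a + 1 by lra.
apply: (@le_trans _ _ (n%:R `^ (a + 1) / (a + 1))); last first.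
  rewrite ler_pM2r ?invr_gt0// ge0_ler_powR ?nnegrE ?ler_nat//; lra.
elim: n => [|n IH]; first by rewrite big_ord0 divr_ge0 ?powR_ge0// ltW.
rewrite big_ord_recr/=; apply: le_trans (lerD IH (lexx _)) _.
have a1 : 0 < a + 1 <= 1 by lra.
have := powR_tangent_le a1 (ler0n R n) (natS0 n).
rewrite natBS addrK mulrN1 => H.
rewrite ler_pdivlMr ?mulrDl ?divfK; lra.
Qed.

Lemma harmonic_sum_le n :
  \sum_(i < n.+1) i.+1%:R `^ (-1) <= 1 + ln n.+1%:R :> R.
Proof.
elim: n => [|n IH]; first by rewrite big_ord1 powR1 ln1 addr0.
rewrite big_ord_recr/=; apply: le_trans (lerD IH (lexx _)) _.
rewrite -addrA lerD2l powR_inv1//.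
have h : -1 < - n.+2%:R^-1 :> R.
  by rewrite ltrN2 invf_lt1// ltr1n.
have := le_ln1Dx h.
(* The logarithm of this ratio is the increment of [ln], so the bound telescopes. *)
have -> : 1 - n.+2%:R^-1 = n.+1%:R / n.+2%:R :> R.
  by rewrite -[n.+1%:R](addrK 1) natr1 mulrBl divff ?pnatr_eq0// div1r.
by rewrite ln_div ?posrE// lerBlDr [_ + ln _]addrC -lerBrDr.
Qed.

Lemma sum_powR_le_ltN1 a n : a < -1 ->
  \sum_(i < n) i.+1%:R `^ a <= 1 - (a + 1)^-1.
Proof.
move=> aN1; have an : a + 1 < 0 by lra.
case: n => [|n].
  by rewrite big_ord0 subr_ge0 (le_trans _ ler01)// invr_le0 ltW.
(* The first term contributes 1 and the telescoping starts from there, since a power with negative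
   exponent has no usable tangent bound at 0. *)
apply: (@le_trans _ _ (1 + (n.+1%:R `^ (a + 1) - 1) / (a + 1))); last first.
  rewrite lerD2l mulrBl div1r gerDr.
  by rewrite mulr_ge0_le0 ?powR_ge0 ?invr_le0 ?ltW.
elim: n => [|n IH]; first by rewrite big_ord1 !powR1 subrr mul0r addr0.
rewrite big_ord_recr/=; apply: le_trans (lerD IH (lexx _)) _.
have := powR_tangent_le0 (ltW an) (natS0 n) (natS0 n.+1).
rewrite natBS addrK mulrN1 => H.
rewrite -addrA lerD2l -(ler_nM2r an) [(_ / _ + _) * _]mulrDl.
rewrite !divfK ?lt_eqF//; lra.
Qed.

(* Young's inequality with exponents [2 / rho] and [2 / (2 - rho)]. *)
Lemma young_power (rho C M r : R) : 0 < rho < 2 -> 0 < C -> 0 <= M -> 0 <= r ->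
  M / rho * r `^ rho - C / 2 * r ^+ 2 <=
  (2 - rho) * M `^ (2 / (2 - rho)) / (2 * rho * C `^ (rho / (2 - rho))).
Proof.
move=> /andP[r0 r2] C0 M0 x0.
have ? : rho != 0 by lra.
have ? : 2 - rho != 0 by lra.
have p0 : 0 < 2 / rho by rewrite divr_gt0//; lra.
have q0 : 0 < 2 / (2 - rho) by rewrite divr_gt0//; lra.
have pq : (2 / rho)^-1 + (2 / (2 - rho))^-1 = 1 :> R.
  by field; apply/andP.
have Ch := powR_gt0 (rho / 2) C0.
(* The factor [C]^ (rho / 2)[is shifted between the two factors of]M * r [^ rho] so that the first
   Young term is exactly [rho / 2 * (C * r ^+ 2)]. *)
have A0 : 0 <= r `^ rho * C `^ (rho / 2) by rewrite mulr_ge0 ?powR_ge0.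
have B0 : 0 <= M / C `^ (rho / 2) by rewrite divr_ge0 ?powR_ge0.
have := conjugate_powR A0 B0 p0 q0 pq.
have -> : r `^ rho * C `^ (rho / 2) * (M / C `^ (rho / 2)) = M * r `^ rho.
  by field; rewrite (gt_eqF Ch).
rewrite powRM ?powR_ge0// -!powRrM.
have -> : rho * (2 / rho) = 2 by field.
have -> : rho / 2 * (2 / rho) = 1 by field.
rewrite powRr1 ?(ltW C0)// powR_mulrn// powR_div// -powRrM.
have -> : rho / 2 * (2 / (2 - rho)) = rho / (2 - rho) by field.
set X := M `^ _; set Y := C `^ (rho / (2 - rho)).
have Y0 : 0 < Y by exact: powR_gt0.
move=> H; rewrite -(ler_pM2l r0).
have -> : rho * (M / rho * r `^ rho - C / 2 * r ^+ 2) =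
  M * r `^ rho - rho / 2 * (C * r ^+ 2) by field.
rewrite lerBlDr (le_trans H)// le_eqVlt; apply/orP; left; apply/eqP.
by field; rewrite (gt_eqF Y0); apply/and3P.
Qed.

End PowerInequalities.

(** * Growth of the weights and the three regimes of the rate *)

Section Rates.
Context {R : realType}.
Implicit Types (p rho : R).

Lemma Ssum_lambdaE p n :
  Ssum (lambda_ p) n = (p + 1)^-1 * \sum_(i < n) i.+1%:R `^ p.
Proof. by rewrite mulr_sumr. Qed.

Lemma Ssum_lambda_ge p n : 0 <= p ->
  n%:R `^ (p + 1) / (p + 1) ^+ 2 <= Ssum (lambda_ p) n.
Proof.
move=> p0; have p1 : 0 < p + 1 by lra.
rewrite Ssum_lambdaE expr2 invfM mulrA mulrC ler_pM2l ?invr_gt0//.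
exact: sum_powR_ge.
Qed.

Lemma Ssum_lambda_le p n : 0 <= p ->
  Ssum (lambda_ p) n <= n.+1%:R `^ (p + 1) / (p + 1) ^+ 2.
Proof.
move=> p0; have p1 : 0 < p + 1 by lra.
rewrite Ssum_lambdaE expr2 invfM mulrA [leRHS]mulrC ler_pM2l ?invr_gt0//.
exact: sum_powR_le.
Qed.

Lemma lambda_gt0 p n : 0 <= p -> 0 < lambda_ p n.
Proof. by move=> p0; rewrite mulr_gt0 ?invr_gt0 ?powR_gt0//; lra. Qed.

Lemma beta_nondecreasing (L sd b p : R) n : 0 <= L / sd + b -> 1 <= p ->
  beta_ L sd b p n <= beta_ L sd b p n.+1.
Proof.
move=> c0 p1; rewrite ler_wpM2l// ge0_ler_powR ?nnegrE ?ler_nat//; lra.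
Qed.

(** The exponent of the summand equals [p - t], so comparing [t] with [p + 1] amounts to comparing
    this exponent with -1: power growth, harmonic sum, or bounded sum. *)
Lemma sum_le_rateP p rho k : 1 <= p -> 1 <= rho < 2 ->
  (p + 1 = (3 * rho - 2) / (2 - rho) -> (1 <= k)%N) ->
  (\sum_(j < k) j.+1%:R `^ (p + 1 - 2 * rho / (2 - rho))) / k.+1%:R `^ (p + 1)
    <= rateP p rho k.
Proof.
move=> p1 /andP[r1 r2]; rewrite /rateP.
set t := (3 * rho - 2) / (2 - rho); set q := p + 2 - _; set a := p + 1 - _.
have tE : 2 * rho / (2 - rho) = t + 1 by rewrite /t; field; lra.
have qE : q = a + 1 by rewrite /q /a; ring.
have aE : a = p - t by rewrite /a tE; ring.
have K0 : 0 < k.+1%:R `^ (p + 1) :> R by rewrite powR_gt0.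
case: ifPn => [tp _|]; last rewrite -leNgt => tp.
  rewrite ler_pdivrMr// -mulrA -powRD; last by rewrite pnatr_eq0 implybT.
  have -> : - t + (p + 1) = a + 1 by rewrite aE; ring.
  by rewrite mulrC qE; apply: sum_powR_le_gtN1; lra.
case: eqVneq => [pt|pt]; rewrite ler_pM2r ?invr_gt0//.
  have -> : a = -1 by lra.
  by move=> /(_ pt); case: (k) => // n _; exact: harmonic_sum_le.
move=> _; rewrite qE; apply: sum_powR_le_ltN1.
suff : p + 1 < t by lra.
by rewrite lt_neqAle pt.
Qed.

End Rates.

(** * Finiteness on [Q] and strong convexity of the Bregman distance *)

Section ConvexPoints.
Context {R : realType} {E : normedVectType R}.
Implicit Types (Q : set E) (d : E -> \bar R) (gd : E -> {scalar E}).

Lemma convex_setP Q (u v : E) (t : R) :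
  convex_set (Q : set (convex_lmodType E)) -> Q u -> Q v -> 0 <= t <= 1 ->
  Q (t *: u + (1 - t) *: v).
Proof.
move=> cQ Qu Qv /andP[t0 t1].
by have := cQ u v (Itv01 t0 t1) (mem_set Qu) (mem_set Qv); rewrite inE.
Qed.

Lemma lsc_convex_fineK Q (h : E -> \bar R) u :
  lsc_convex Q h -> Q u -> h u = (fine (h u))%:E.
Proof.
move=> lh Qu; rewrite fineK// fin_numE (lsc_convex_ninfty lh).
by rewrite lt_eqF// (lsc_convex_dom lh).
Qed.

Lemma prox_fineK Q d gd (sd : R) (x0 u : E) :
  prox_function Q d gd sd x0 -> Q u -> d u = (fine (d u))%:E.
Proof.
move=> pd Qu.
by rewrite fineK// fin_numE (prox_ninfty pd) lt_eqF// (prox_dom pd).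
Qed.

(* Apply strong convexity on the segment from [y] to [u] at parameter [t] and
   let [t] tend to 0. *)
Lemma xi_ge Q d gd (sd : R) (x0 y u : E) :
  convex_set (Q : set (convex_lmodType E)) -> prox_function Q d gd sd x0 ->
  Q y -> Q u -> sd / 2 * `|u - y| ^+ 2 <= xi d gd y u.
Proof.
move=> cQ pd Qy Qu.
have [->|yu] := eqVneq u y.
  by rewrite /xi /ld !subrr raddf0 addr0 subrr normr0 expr0n mulr0.
have r0 : 0 < `|u - y| by rewrite normr_gt0 subr_eq0.
set r := `|u - y| in r0 *.
have sd0 := prox_sd_gt0 pd.
apply/ler_addgt0Pl => e e0.
have e2r : 0 < e / 2 / r by rewrite !divr_gt0.
have [+ _] := prox_C1 pd.
move=> /(_ y Qy _ e2r)/nbhs_ballP[eta /= eta0 Heta].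
(* The three bounds keep the point on the segment, put it in the ball where the first-order
   remainder is small, and make the loss [sd / 2 * t * r ^+ 2] at most [e / 2]. *)
pose t := Num.min 1 (Num.min (eta / (2 * r)) (e / (sd * r ^+ 2))).
have t0 : 0 < t.
  by rewrite !lt_min ltr01 !divr_gt0 ?mulr_gt0 ?exprn_gt0.
have t1 : t <= 1 by rewrite ge_min lexx.
have tr : t * r < eta.
  have : t <= eta / (2 * r) by rewrite !ge_min lexx ?orbT.
  by rewrite ler_pdivlMr ?mulr_gt0//; nra.
have te : sd / 2 * t * r ^+ 2 <= e / 2.
  have : t <= e / (sd * r ^+ 2) by rewrite !ge_min lexx ?orbT.
  by rewrite ler_pdivlMr ?mulr_gt0 ?exprn_gt0//; lra.
pose yt := t *: u + (1 - t) *: y.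
have t01 : 0 <= t <= 1 by rewrite ltW.
have Qt : Q yt by exact: convex_setP.
have ytE : yt - y = t *: (u - y).
  by rewrite /yt scalerBl scale1r addrA addrAC addrK scalerBr.
have nyt : `|yt - y| = t * r by rewrite ytE normrZ gtr0_norm.
have bt : ball y eta yt by rewrite -ball_normE /= distrC nyt.
have := Heta _ bt Qt.
rewrite nyt {1}/xi /ld ytE linearZ /= => /ler_normlP[+ _].
have := prox_strong pd Qu Qy t01.
rewrite -/yt (prox_fineK pd Qt) (prox_fineK pd Qu) (prox_fineK pd Qy).
rewrite -!EFinM -!EFinD lee_fin.
rewrite -/r /xi /ld.
set g := gd y (u - y); set dt := fine (d yt); set du := fine (d u).
set dy := fine (d y).
have -> : e / 2 / r * (t * r) = t * (e / 2) by field; lra.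
move=> H1 /= H2.
rewrite -(ler_pM2l t0) mulrDr.
have H3 : t * (sd / 2 * t * r ^+ 2) <= t * (e / 2) by by rewrite ler_pM2l.
lra.
Qed.

Lemma xi_ge0 Q d gd (sd : R) (x0 y u : E) :
  convex_set (Q : set (convex_lmodType E)) -> prox_function Q d gd sd x0 ->
  Q y -> Q u -> 0 <= xi d gd y u.
Proof.
move=> cQ pd Qy Qu; apply: le_trans (xi_ge cQ pd Qy Qu).
by rewrite mulr_ge0 ?exprn_ge0 ?divr_ge0// ltW// (prox_sd_gt0 pd).
Qed.

End ConvexPoints.

(** * Descent of the method for general weights and abstract step errors *)

Section MethodS.
Context {R : realType} {E : normedVectType R}.
Variables (Q : set E) (f : E -> \bar R) (xstar : E).
Variables (d : E -> \bar R) (gd : E -> {scalar E}) (sd : R) (x0 : E).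
Variables (m : E -> E -> \bar R) (sf sbf : R).
Variables (L : E -> R) (delta : E -> E -> R).
Variables (lam beta : nat -> R) (phi psi : nat -> E -> \bar R).
Variables (x xh z w : nat -> E).

Hypothesis cQ : convex_set (Q : set (convex_lmodType E)).
Hypothesis lf : lsc_convex Q f.
Hypothesis minf : is_argmin Q f xstar.
Hypothesis pd : prox_function Q d gd sd x0.
Hypothesis sp : SP_class Q d gd f m sf sbf L delta.
Hypothesis lam_gt0 : forall n, 0 < lam n.
Hypothesis beta_ge0 : forall n, 0 <= beta n.
Hypothesis beta_nd : forall n, beta n <= beta n.+1.
Hypothesis p2 : property2 Q d gd m sf lam beta x0 phi psi x z w.
Hypothesis mm : modified_method lam x0 x xh z w.

Local Notation S := (Ssum lam).

Let sf0 : 0 <= sf.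
Proof. by have /andP[] := SP_sbf sp; exact: le_trans. Qed.

Let Ssum_ge0 n : 0 <= S n.
Proof. by apply: sumr_ge0 => i _; exact: ltW. Qed.

Lemma SsumS n : S n.+1 = S n + lam n.
Proof. exact: big_ord_recr. Qed.

Let SsumS_gt0 n : 0 < S n.+1.
Proof. by rewrite SsumS ltr_wpDl. Qed.

Let Qz n : Q (z n). Proof. by have [] := P2_z p2 n. Qed.
Let Qw n : Q (w n). Proof. by have [] := P2_w p2 n. Qed.

(* [\hat x_(n-1)]; at [n = 0] its weight [S 0] vanishes, and [x0] is only a
   placeholder that makes the first iteration an instance of the general one. *)
Let xprev n := if n is k.+1 then xh k else x0.

Let averageE (n : nat) (u v : E) : (S n.+1)^-1 *: (S n *: u + lam n *: v) =
  (S n / S n.+1) *: u + (1 - S n / S n.+1) *: v.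
Proof.
rewrite scalerDr !scalerA mulrC; congr (_ + _ *: _).
have := lt0r_neq0 (SsumS_gt0 n); rewrite SsumS => S0.
by field.
Qed.

Let weight01 n : 0 <= S n / S n.+1 <= 1.
Proof.
apply/andP; split; first by apply: divr_ge0 => //; exact: ltW.
by rewrite ler_pdivrMr// mul1r SsumS lerDl ltW.
Qed.

Let Q_average n (u v : E) : Q u -> Q v ->
  Q ((S n.+1)^-1 *: (S n *: u + lam n *: v)).
Proof. by move=> Qu Qv; rewrite averageE; exact: convex_setP. Qed.

Let xE n : x n = (S n.+1)^-1 *: (S n *: xprev n + lam n *: z n).
Proof.
case: n => [|n]; last exact: (MM_x mm).
rewrite (MM_x0 mm) SsumS {1 2}/Ssum big_ord0 add0r scale0r add0r.
have [_ [-> _]] := P2_B1 p2.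
by rewrite scalerA mulVf ?scale1r// gt_eqF.
Qed.

Let xhE n : xh n = (S n.+1)^-1 *: (S n *: xprev n + lam n *: w n.+1).
Proof.
case: n => [|n]; last exact: (MM_xh mm).
rewrite (MM_xh0 mm) SsumS {1 2}/Ssum big_ord0 add0r scale0r add0r.
by rewrite scalerA mulVf ?scale1r// gt_eqF.
Qed.

Let Q_xprev n : Q (xprev n).
Proof.
elim: n => [|n IH] /=; first by have [] := prox_argmin pd.
by rewrite xhE; exact: Q_average.
Qed.

Lemma method_xh_in k : Q (xh k). Proof. exact: (Q_xprev k.+1). Qed.

Lemma method_x_in n : Q (x n).
Proof. by rewrite xE; exact: Q_average. Qed.

Let mfineK n u : Q u -> m (x n) u = (fine (m (x n) u))%:E.
Proof.
by apply: lsc_convex_fineK; exact: (SP_model sp (method_x_in n)).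
Qed.

Let psi_le n u : Q u -> (psi n (w n) <=
  (\sum_(i < n) lam i * fine (m (x i) u) + beta n * ld d gd (z n) u
    - S n * sf * xi d gd (z n) u)%:E)%E.
Proof.
move=> Qu; apply: le_trans (P2_B3 p2 n) _; apply: ereal_inf_lbound.
exists u => //; rewrite EFinB EFinD -sumEFin; congr (_ + _ - _)%E.
by apply: eq_bigr => i _; rewrite mfineK// EFinM.
Qed.

(** (B3) evaluated at [w n] itself bounds the value above by a real number. *)
Let psi_fineK n : psi n (w n) = (fine (psi n (w n)))%:E.
Proof.
rewrite fineK// fin_numE; have [_ ->] := P2_ninfty p2 n (Qw n) => /=.
by rewrite lt_eqF// (le_lt_trans (psi_le n (Qw n)))// ltry.
Qed.

Let B2_fine n :
  fine (psi n (w n)) + lam n * fine (m (x n) (w n.+1))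
    + beta n.+1 * fine (d (w n.+1)) - beta n * ld d gd (z n) (w n.+1)
    + S n * sf * xi d gd (z n) (w n.+1)
  <= fine (psi n.+1 (w n.+1)).
Proof.
rewrite -lee_fin -psi_fineK.
apply: le_trans (P2_B2 p2 n (Qw n.+1)).
rewrite mfineK// (prox_fineK pd)// !EFinD !EFinM EFinN -psi_fineK.
do 4 apply: leeD => //.
(* The coupling enters here: [psi n (w n) <= psi n (z n) <= phi n (z n)], by minimality and (B0). *)
by have [_ H] := P2_w p2 n; apply: le_trans (H _ (Qz n)) (P2_B0 p2 n (Qz n)).
Qed.

(** [e n] bounds what remains of the upper model at [x n] after the gain of the step is subtracted.
    With [u = xh n], the scaled distance is [|w n.+1 - z n|]; the term [sd * sbf] comes from
    bounding [sbf * xi] below. *)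
Variable e : nat -> R.
Hypothesis e_ge : forall n u, Q u ->
  S n.+1 * (delta (x n) u + (L (x n) - sd * sbf) / 2 * `|x n - u| ^+ 2)
    - (beta n + S n * sf) * (sd / 2) * (S n.+1 / lam n * `|x n - u|) ^+ 2
  <= e n.

(** The upper model at [xh n] is split by convexity of [m (x n)]: its part at [xprev n] is below [f]
    and falls under the induction hypothesis, and its part at [w n.+1] is supplied by (B2). *)
Let step n err : S n * fine (f (xprev n)) <= fine (psi n (w n)) + err ->
  S n.+1 * fine (f (xh n)) <= fine (psi n.+1 (w n.+1)) + (err + e n).
Proof.
move=> IH; have Qx := method_x_in n; have Qh := method_xh_in n.
have Qp := Q_xprev n; have Qw1 := Qw n.+1.
have sd0 := prox_sd_gt0 pd; have /andP[sbf0 _] := SP_sbf sp.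
have minor : fine (m (x n) (xprev n)) <= fine (f (xprev n)).
  rewrite -lee_fin -mfineK// -(lsc_convex_fineK lf)//.
  exact: (SP_minor sp).
have convex : S n.+1 * fine (m (x n) (xh n)) <=
    S n * fine (m (x n) (xprev n)) + lam n * fine (m (x n) (w n.+1)).
  have := lsc_convex_convex (SP_model sp Qx) I I (weight01 n)
    (x := xprev n) (y := w n.+1).
  rewrite -averageE -xhE (mfineK _ Qh) (mfineK _ Qp) (mfineK _ Qw1).
  rewrite -!EFinM -EFinD lee_fin.
  rewrite -(ler_pM2l (SsumS_gt0 n)) => /le_trans; apply.
  rewrite le_eqVlt; apply/orP; left; apply/eqP.
  have := lt0r_neq0 (SsumS_gt0 n); rewrite SsumS => S0.
  by field.
have upper : fine (f (xh n)) <= fine (m (x n) (xh n))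
    - sbf * xi d gd (x n) (xh n) + L (x n) / 2 * `|x n - xh n| ^+ 2
    + delta (x n) (xh n).
  have := SP_upper sp Qx Qh.
  by rewrite mfineK// (lsc_convex_fineK lf)// -EFinB -!EFinD lee_fin.
have xi1 := xi_ge cQ pd Qx Qh; rewrite distrC in xi1.
have xi2 := xi_ge cQ pd (Qz n) Qw1.
(* [x n] and [xh n] are the same average except for the last point, [z n] or [w n.+1]. *)
have dist : `|w n.+1 - z n| = S n.+1 / lam n * `|x n - xh n|.
  rewrite distrC xE xhE -scalerBr opprD addrACA subrr add0r -scalerBr.
  have S0 := SsumS_gt0 n; have l0 := lam_gt0 n.
  rewrite !normrZ !gtr0_norm ?invr_gt0//.
  by field; rewrite !gt_eqF.
rewrite dist in xi2.
have d0 : 0 <= fine (d (w n.+1)) by rewrite fine_ge0// (prox_ge0 pd).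
have B2 := B2_fine n; have err_n := e_ge n Qh.
have bS : 0 <= beta n + S n * sf by rewrite addr_ge0// mulr_ge0.
have A1 := ler_wpM2l (Ssum_ge0 n) minor.
have A2 := ler_wpM2l (ltW (SsumS_gt0 n)) upper.
have A3 := ler_wpM2l (mulr_ge0 (ltW (SsumS_gt0 n)) sbf0) xi1.
have A4 := ler_wpM2l bS xi2.
(* Monotone scaling and [d >= 0] allow [beta n.+1] to be lowered to [beta n], so that (B2) yields
   the full multiple [beta n] of [xi]. *)
have A5 := ler_wpM2r d0 (beta_nd n).
have ldE : ld d gd (z n) (w n.+1) = fine (d (w n.+1)) - xi d gd (z n) (w n.+1).
  by rewrite /xi; ring.
rewrite ldE in B2.
lra.
Qed.

Lemma method_descent k : S k.+1 * fine (f (xh k)) <=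
  fine (psi k.+1 (w k.+1)) + \sum_(n < k.+1) e n.
Proof.
have psi0 : fine (psi 0%N (w 0%N)) = 0 by have [->] := P2_B1 p2.
elim: k => [|k IH].
  (* The induction starts one step earlier, from [0 <= 0], as [S 0] and the first minimum of [psi]
     both vanish. *)
  rewrite big_ord1 -[e _]add0r; apply: step.
  by rewrite psi0 addr0 /Ssum big_ord0 mul0r.
by rewrite big_ord_recr; exact: step.
Qed.

Lemma method_rate k :
  S k.+1 * (fine (f (xh k)) - fine (f xstar) + sf * xi d gd (z k.+1) xstar)
  <= beta k.+1 * ld d gd (z k.+1) xstar + \sum_(n < k.+1) e n.
Proof.
have [Qs _] := minf.
have := psi_le k.+1 Qs; rewrite psi_fineK lee_fin => B3.
have D := method_descent k.
have sum_le : \sum_(i < k.+1) lam i * fine (m (x i) xstar)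
    <= S k.+1 * fine (f xstar).
  rewrite mulr_suml; apply: ler_sum => i _; rewrite ler_pM2l//.
  rewrite -lee_fin -mfineK// -(lsc_convex_fineK lf)//.
  exact: (SP_minor sp (method_x_in i) Qs).
lra.
Qed.

End MethodS.

(** * Step errors for the polynomial weights and their sum *)

Section StepErrors.
Context {R : realType}.
Variables (p L sd b sf sbf rho : R).
Hypotheses (p_ge1 : 1 <= p) (L_ge0 : 0 <= L) (sd_gt0 : 0 < sd) (b_ge0 : 0 <= b).
Hypotheses (sf_gt0 : 0 < sf) (sbf_ge0 : 0 <= sbf) (rho_bound : 1 <= rho < 2).

Local Notation lam := (lambda_ p).
Local Notation S := (Ssum lam).
Local Notation beta := (beta_ L sd b p).
Local Notation C0 := (sd * sbf + p * L + (p + 1) * sd * b).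
Local Notation K := (2 `^ (p - 1) * (p + 1) ^+ 2 / (sd * sf)).

Hypothesis C0_gt0 : 0 < C0.

(** A closed-form lower bound for the curvature left after a step, exact at [n = 0]. Keeping the
    first step apart produces the separate second term of the estimate. *)
Definition step_curvature n : R := if n is j.+1 then j.+1%:R ^+ 2 / K else C0.

(** The bound from Young's inequality with the power of [M] abstracted to [N], so that a maximum can
    be substituted later. *)
Definition step_error (N : R) n : R :=
  S n.+1 * ((2 - rho) * N /
            (2 * rho * step_curvature n `^ (rho / (2 - rho)))).

Let p1_gt0 : 0 < p + 1. Proof. by move: p_ge1 => ?; lra. Qed.

Let powR_pred1 (v : R) : 0 <= v -> v `^ p = v * v `^ (p - 1).
Proof. by move=> v0; rewrite mulr_powRB1// (lt_le_trans ltr01 p_ge1). Qed.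

Let powR_succ1 (v : R) : 0 <= v -> v `^ (p + 1) = v * (v * v `^ (p - 1)).
Proof. by move=> v0; rewrite -powR_pred1// -(mulr_powRB1 v0 p1_gt0) addrK. Qed.

Let K_gt0 : 0 < K.
Proof. by rewrite divr_gt0 ?mulr_gt0 ?exprn_gt0 ?powR_gt0. Qed.

Let c_ge0 : 0 <= L / sd + b.
Proof. by rewrite addr_ge0// divr_ge0// ltW. Qed.

Let S_ge0 n : 0 <= S n.
Proof.
by apply: sumr_ge0 => i _; exact/ltW/lambda_gt0/(le_trans ler01 p_ge1).
Qed.

Lemma step_curvature_gt0 n : 0 < step_curvature n.
Proof. by case: n => [//|n]; rewrite divr_gt0 ?exprn_gt0. Qed.

(** For positive index, the [beta] part of the gain compensates [- L], and the [sf] part alone gives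
    quadratic growth. *)
Lemma step_curvature_le n : step_curvature n <=
  sd * sbf - L + sd * (beta n + S n * sf) * (S n.+1 / lam n ^+ 2).
Proof.
move: (p_ge1) (p1_gt0) => p1 p10.
have l0 := lambda_gt0 n (le_trans ler01 p_ge1).
case: n l0 => [|n] l0.
  rewrite /Ssum big_ord1 big_ord0 /step_curvature /beta_ /lambda_ !powR1.
  rewrite le_eqVlt; apply/orP; left; apply/eqP.
  by field; apply/andP; split; apply: lt0r_neq0.
have n1 : 0 < n.+1%:R :> R by [].
have n2 : 0 < n.+2%:R :> R by [].
pose T : R := n.+2%:R `^ (p - 1).
have T0 : 0 < T by exact: powR_gt0.
have T_le : T <= 2 `^ (p - 1) * n.+1%:R `^ (p - 1).
  rewrite -powRM// ge0_ler_powR ?nnegrE ?mulr_ge0 ?subr_ge0//.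
  by rewrite -natrM ler_nat mul2n -addnn addSnnS leq_addl.
have ratio : T^-1 <= S n.+2 / lam n.+1 ^+ 2.
  rewrite ler_pdivlMr ?exprn_gt0// mulrC.
  have p0 : 0 <= p by lra.
  apply: le_trans (Ssum_lambda_ge n.+2 p0).
  rewrite le_eqVlt; apply/orP; left; apply/eqP.
  rewrite /lambda_ /T powR_succ1// powR_pred1// -/T.
  by field; rewrite !lt0r_neq0.
(* The power in [beta] cancels [T] exactly, leaving [L + sd * b]. *)
have first : L <= sd * beta n.+1 * (S n.+2 / lam n.+1 ^+ 2).
  have sb0 : 0 <= sd * beta n.+1 by rewrite !mulr_ge0 ?powR_ge0// ltW.
  apply: le_trans (ler_wpM2l sb0 ratio).
  have -> : sd * beta n.+1 / T = L + sd * b.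
    by rewrite /beta_ -/T; field; rewrite !lt0r_neq0.
  by rewrite lerDl mulr_ge0// ltW.
have second : n.+1%:R ^+ 2 / K <=
    sd * (S n.+1 * sf) * (S n.+2 / lam n.+1 ^+ 2).
  have p0 : 0 <= p by lra.
  have SS : n.+1%:R `^ (p + 1) / (p + 1) ^+ 2 / T <=
      S n.+1 * (S n.+2 / lam n.+1 ^+ 2).
    apply: ler_pM => //; last exact: Ssum_lambda_ge.
      by rewrite divr_ge0 ?powR_ge0 ?exprn_ge0// ltW.
    by rewrite invr_ge0 ltW.
  have -> : sd * (S n.+1 * sf) * (S n.+2 / lam n.+1 ^+ 2) =
    sd * sf * (S n.+1 * (S n.+2 / lam n.+1 ^+ 2)) by ring.
  have ss0 : 0 < sd * sf by rewrite mulr_gt0.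
  apply: le_trans (ler_wpM2l (ltW ss0) SS).
  rewrite powR_succ1// mulrA -expr2.
  set q := n.+1%:R ^+ 2; set P := n.+1%:R `^ (p - 1); set Z := 2 `^ (p - 1).
  have Z0 : 0 < Z by exact: powR_gt0.
  have q0 : 0 < q by rewrite exprn_gt0.
  have -> : sd * sf * (q * P / (p + 1) ^+ 2 / T) =
    (q * (sd * sf) / (p + 1) ^+ 2) * (P / T).
    by field; rewrite !lt0r_neq0.
  have -> : q / (Z * (p + 1) ^+ 2 / (sd * sf)) =
    (q * (sd * sf) / (p + 1) ^+ 2) * Z^-1.
    by field; rewrite !lt0r_neq0.
  rewrite ler_pM2l; last by rewrite divr_gt0 ?exprn_gt0// mulr_gt0.
  by rewrite ler_pdivlMr// mulrC ler_pdivrMr// mulrC.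
have sbf0 : 0 <= sd * sbf by rewrite mulr_ge0// ltW.
rewrite /step_curvature; lra.
Qed.

(** Once [S n.+1] is factored out, the coefficient of [- r ^+ 2 / 2] is the right-hand side of
    [step_curvature_le], so [young_power] applies. *)
Lemma step_error_ge (M : R) n (r : R) : 0 <= M -> 0 <= r ->
  S n.+1 * (M / rho * r `^ rho + (L - sd * sbf) / 2 * r ^+ 2)
    - (beta n + S n * sf) * (sd / 2) * (S n.+1 / lam n * r) ^+ 2
  <= step_error (M `^ (2 / (2 - rho))) n.
Proof.
move=> M0 r0.
have l0 := lambda_gt0 n (le_trans ler01 p_ge1).
have rho2 : 0 < rho < 2 by move: rho_bound => ?; lra.
have Y := young_power rho2 (step_curvature_gt0 n) M0 r0.
apply: le_trans (ler_wpM2l (S_ge0 n.+1) Y).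
have r20 : 0 <= r ^+ 2 / 2 by rewrite divr_ge0// exprn_ge0.
have H := ler_wpM2l (S_ge0 n.+1) (ler_wpM2r r20 (step_curvature_le n)).
have -> : (S n.+1 / lam n * r) ^+ 2 = S n.+1 * (S n.+1 / lam n ^+ 2) * r ^+ 2.
  by field; rewrite lt0r_neq0.
lra.
Qed.

Lemma step_error_le (N N' : R) n : N <= N' -> step_error N n <= step_error N' n.
Proof.
move=> NN; have /andP[rho1 rho2] := rho_bound.
rewrite ler_wpM2l// ler_pM2r ?invr_gt0.
  by rewrite ler_wpM2l//; lra.
by rewrite !mulr_gt0 ?powR_gt0 ?step_curvature_gt0//; lra.
Qed.

Lemma sum_step_error_le N k : 0 <= N ->
  (p + 1 = (3 * rho - 2) / (2 - rho) -> (1 <= k)%N) ->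
  (p + 1) ^+ 2 / k.+1%:R `^ (p + 1) * \sum_(n < k.+1) step_error N n <=
    (p + 1) * (2 - rho) * N / (2 * rho * C0 `^ (rho / (2 - rho)))
      * (k.+1%:R `^ (p + 1))^-1
    + 3 `^ (p + 1) * (2 - rho) * N / (2 * rho) * K `^ (rho / (2 - rho))
      * rateP p rho k.
Proof.
move: (p_ge1) (p1_gt0) => p1 p10 N0 kP; have /andP[rho1 rho2] := rho_bound.
have C0w : 0 < C0 `^ (rho / (2 - rho)) by exact: powR_gt0.
have Kw : 0 < K `^ (rho / (2 - rho)) by exact: powR_gt0.
have k0 : 0 < k.+1%:R `^ (p + 1) :> R by exact: powR_gt0.
(* The step [n = 0] equals the [C0] term; the other [k] steps form the power sum bounded by
   [rateP]. *)
rewrite big_ord_recl mulrDr; apply: lerD.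
  rewrite /step_error /Ssum big_ord1 /lambda_ powR1 /step_curvature.
  rewrite le_eqVlt; apply/orP; left; apply/eqP.
  by field; rewrite !lt0r_neq0//; lra.
have A0 : 0 <= 3 `^ (p + 1) * (2 - rho) * N / (2 * rho)
    * K `^ (rho / (2 - rho)).
  by rewrite !mulr_ge0 ?invr_ge0 ?powR_ge0//; lra.
apply: le_trans (ler_wpM2l A0 (sum_le_rateP p_ge1 rho_bound kP)).
rewrite [leRHS]mulrA ler_pdivlMr//.
have -> : forall s : R,
    (p + 1) ^+ 2 / k.+1%:R `^ (p + 1) * s * k.+1%:R `^ (p + 1) =
    (p + 1) ^+ 2 * s.
  by move=> s; field; rewrite lt0r_neq0.
rewrite !mulr_sumr; apply: ler_sum => j _.
rewrite /step_error lift0.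
have j1 : 0 < j.+1%:R :> R by [].
have p0 : 0 <= p by lra.
have -> : step_curvature j.+1 `^ (rho / (2 - rho)) =
    j.+1%:R `^ (2 * rho / (2 - rho)) / K `^ (rho / (2 - rho)).
  rewrite /step_curvature (powR_div _ K_gt0) ?exprn_ge0//.
  have -> : j.+1%:R ^+ 2 = j.+1%:R `^ 2 :> R by rewrite powR_mulrn.
  by rewrite -powRrM mulrA.
rewrite powRB ?pnatr_eq0 ?implybT//.
set J := j.+1%:R `^ (2 * _ / _); set W := K `^ _.
have J0 : 0 < J by exact: powR_gt0.
have SJ : (p + 1) ^+ 2 * S j.+2 <= 3 `^ (p + 1) * j.+1%:R `^ (p + 1).
  rewrite -ler_pdivlMl ?exprn_gt0// mulrC.
  apply: le_trans (Ssum_lambda_le j.+2 p0) _.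
  rewrite ler_pM2r ?invr_gt0 ?exprn_gt0// -powRM//.
  rewrite ge0_ler_powR ?nnegrE ?mulr_ge0 ?(ltW p10)//.
  by rewrite -natrM ler_nat mulnS -[j.+3]/(3 + j)%N leq_add2l leq_pmull.
have F0 : 0 <= (2 - rho) * N / (2 * rho) * W / J.
  rewrite divr_ge0 ?(ltW J0)// mulr_ge0 ?(ltW Kw)// divr_ge0 ?mulr_ge0//; lra.
have -> : (p + 1) ^+ 2 * (S j.+2 * ((2 - rho) * N / (2 * rho * (J / W)))) =
    (p + 1) ^+ 2 * S j.+2 * ((2 - rho) * N / (2 * rho) * W / J).
  by field; rewrite !lt0r_neq0//; lra.
apply: le_trans (ler_wpM2r F0 SJ) _.
by rewrite le_eqVlt; apply/orP; left; apply/eqP; ring.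
Qed.

End StepErrors.

(** * Assembly of the convergence estimate *)

Theorem theorem5p6 (R : realType) (E : normedVectType R) (Q : set E)
    (f : E -> \bar R) (xstar : E)
    (d : E -> \bar R) (gd : E -> {scalar E}) (sd : R) (x0 : E)
    (m : E -> E -> \bar R) (sf sbf L rho : R) (M : E -> R)
    (p b : R)
    (phi psi : nat -> E -> \bar R) (x xh z w : nat -> E) :
  closed Q -> convex_set (Q : set (convex_lmodType E)) ->
  lsc_convex Q f -> is_argmin Q f xstar ->
  prox_function Q d gd sd x0 ->
  0 <= L -> 0 < sf -> 1 <= rho < 2 -> (forall y, Q y -> 0 <= M y) ->
  SP_class Q d gd f m sf sbf (fun=> L)
    (fun y u => M y / rho * `|y - u| `^ rho) ->
  1 <= p -> 0 <= b ->
  0 < sd * sbf + p * L + (p + 1) * sd * b ->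
  property2 Q d gd m sf (lambda_ p) (beta_ L sd b p) x0 phi psi x z w ->
  modified_method (lambda_ p) x0 x xh z w ->
  forall k : nat,
  (p + 1 = (3 * rho - 2) / (2 - rho) -> (1 <= k)%N) ->
  let maxM := \big[Num.max/0]_(i < k.+1) (M (x i) `^ (2 / (2 - rho))) in
  (f (xh k) - f xstar + (sf * xi d gd (z k.+1) xstar)%:E <=
   ((L / sd + b) * (p + 1) ^+ 2 * ld d gd (z k.+1) xstar
      * (k.+2%:R `^ (p - 1) / k.+1%:R `^ (p + 1))
    + (p + 1) * (2 - rho) * maxM
        / (2 * rho * (sd * sbf + p * L + (p + 1) * sd * b)
                       `^ (rho / (2 - rho)))
        * (k.+1%:R `^ (p + 1))^-1
    + 3 `^ (p + 1) * (2 - rho) * maxM / (2 * rho)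
        * (2 `^ (p - 1) * (p + 1) ^+ 2 / (sd * sf)) `^ (rho / (2 - rho))
        * rateP p rho k)%:E)%E.
Proof.
move=> _ cQ lf minf pd L0 sf0 rho12 M0 sp p1 b0 C0 p2 mm k kP.
cbv zeta; set maxM := \big[Num.max/0]_(i < k.+1) _.
have sd0 := prox_sd_gt0 pd; have p0 : 0 <= p by lra.
have /andP[sbf0 _] := SP_sbf sp.
have c0 : 0 <= L / sd + b by rewrite addr_ge0// divr_ge0// ltW.
have lam0 n : 0 < lambda_ p n by exact: lambda_gt0.
have beta0 n : 0 <= beta_ L sd b p n by rewrite mulr_ge0 ?powR_ge0.
have beta_nd n := beta_nondecreasing n c0 p1.
have Qx := method_x_in cQ pd lam0 p2 mm.
have Qxh := method_xh_in cQ pd lam0 p2 mm k.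
have [Qs fmin] := minf; have Qz : Q (z k.+1) by have [] := P2_z p2 k.+1.
pose N n := M (x n) `^ (2 / (2 - rho)).
have rate := @method_rate _ _ Q f xstar d gd sd x0 m sf sbf (fun=> L) _
  (lambda_ p) (beta_ L sd b p) phi psi x xh z w cQ lf minf pd sp lam0 beta0
  beta_nd p2 mm (fun n => step_error p L sd b sf sbf rho (N n) n)
  (fun n u Qu => step_error_ge p1 L0 sd0 b0 sf0 sbf0 rho12 C0 n
     (M0 _ (Qx n)) (normr_ge0 (x n - u))) k.
have fxs := lsc_convex_fineK lf Qs; have fxh := lsc_convex_fineK lf Qxh.
(* The entries are powers, hence nonnegative, so the default value 0 does not alter the maximum. *)
have N_ge0 : 0 <= maxM.
  by apply: le_trans (powR_ge0 _ _) (le_bigmax _ _ ord0).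
have err : \sum_(n < k.+1) step_error p L sd b sf sbf rho (N n) n <=
    \sum_(n < k.+1) step_error p L sd b sf sbf rho maxM n.
  apply: ler_sum => i _; apply: step_error_le => //.
  exact: (le_bigmax _ (fun i : 'I_k.+1 => N i)).
have total := sum_step_error_le p1 sd0 sf0 rho12 C0 N_ge0 kP.
rewrite fxs fxh -EFinB -EFinD lee_fin -[leRHS]addrA.
apply: le_trans (lerD (lexx _) total).
set A := fine _ - _ + _ in rate *.
(* [ld] may be negative, so the lower bound on [S] has to be used on the
   nonnegative left-hand side. *)
have A0 : 0 <= A.
  apply: addr_ge0; first by rewrite subr_ge0 -lee_fin -fxs -fxh fmin.
  by rewrite mulr_ge0 ?(ltW sf0)// (xi_ge0 cQ pd).
have k0 : 0 < k.+1%:R `^ (p + 1) :> R by exact: powR_gt0.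
have p10 : 0 < (p + 1) ^+ 2 by rewrite exprn_gt0//; lra.
have D0 : 0 < (p + 1) ^+ 2 / k.+1%:R `^ (p + 1) by rewrite divr_gt0.
have SA := le_trans (ler_wpM2r A0 (Ssum_lambda_ge k.+1 p0)) rate.
have := ler_wpM2l (ltW D0) (le_trans SA (lerD (lexx _) err)).
(* The multiplier is the inverse of the lower bound on [S k.+1], so the left-hand side reduces to
   [A]. *)
have -> : forall a, (p + 1) ^+ 2 / k.+1%:R `^ (p + 1) *
    (k.+1%:R `^ (p + 1) / (p + 1) ^+ 2 * a) = a.
  by move=> a; field; rewrite !lt0r_neq0//; lra.
rewrite mulrDr => /le_trans; apply; rewrite lerD2r.
by rewrite le_eqVlt; apply/orP; left; apply/eqP; rewrite /beta_; ring.
Qed.
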